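(* Let $\sigma<-1$ and let $F(a,b)=\operatorname{sgn}(\sigma)\,|A|^{\sigma}=-(a^2+b^2)^{\sigma/2}$ for $a,b>0$, where $|A|=(a^2+b^2)^{1/2}$. Then there exists no maximum-principle function (MPF) for the normal velocity $F$.
   Context: Notation: $\mathbb{R}^2_+=(0,\infty)^2$; subscripts $a,b$ denote partial derivatives. Normal velocity: a symmetric function $F\in C^2(\mathbb{R}^2_+)$, homogeneous of some degree $\sigma\in\mathbb{R}\setminus\{0\}$, with $F_a,F_b>0$ for all $a,b>0$. It is contracting if $F>0$ everywhere on $\mathbb{R}^2_+$ and expanding if $F<0$ everywhere on $\mathbb{R}^2_+$. Maximum-principle function (MPF) for a normal velocity $F$: a symmetric function $w\in C^2(\mathbb{R}^2_+)$, homogeneous of some degree $\chi\in\mathbb{R}\setminus\{0\}$, such that, with $\alpha=-w_a/w_b$ and $\alpha_a=\partial\alpha/\partial a$ (defined for $a\ne b$): (1) $w>0$ whenever $a\neq b$, and $w=0$ whenever $a=b$. (2) $\chi>0$ if $F$ is contracting, $\chi<0$ if $F$ is expanding. (3) $w_a<0$ for all $0<a<b$, and $w_a>0$ for all $0<b<a$. (4) For all $a,b>0$ (for $E_w,G_w$: $a\neq b$) one has $C_w(a,b)\le0$, $E_w(a,b)\le0$, $G_w(a,b)\le 0$, where $$C_w=w_a\,a\big((F_aa^2+F_bb^2)+(F-F_aa-F_bb)a\big)+w_b\,b\big((F_aa^2+F_bb^2)+(F-F_aa-F_bb)b\big),$$ $$E_w=w_a(F_{aa}+2F_{ab}\alpha+F_{bb}\alpha^2)-F_a(w_{aa}+2w_{ab}\alpha+w_{bb}\alpha^2)+2\,\frac{w_bF_a-w_aF_b}{a-b}\,\alpha^2,$$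 $$G_w=\frac1{\alpha^2}\Big(w_b(F_{aa}+2F_{ab}\alpha+F_{bb}\alpha^2)-F_b(w_{aa}+2w_{ab}\alpha+w_{bb}\alpha^2)+2\,\frac{w_bF_a-w_aF_b}{a-b}\Big).$$ (5) There are constants $c>0$, $d\in\mathbb{R}$ such that, evaluating $\alpha$ and $\alpha_a$ at $(a,b)=(\rho,1)$ with $0<\rho<1$: if $F$ is contracting, then either $\alpha=c$ and $\alpha_a=0$ for all sufficiently small $\rho$, or, as $\rho\to0$, $\alpha=\frac c\rho+o(\rho^{-1})$ and $\alpha_a=-\frac c{\rho^2}+o(\rho^{-1})$; if $F$ is expanding, then, as $\rho\to0$, either $\alpha=\frac c\rho+o(\rho^{-1})$ and $\alpha_a=-\frac c{\rho^2}+o(\rho^{-1})$, or $\alpha=\frac{c+d\rho}{\rho^2}+o(\rho^{-1})$ and $\alpha_a=-\frac{2c+d\rho}{\rho^3}+o(\rho^{-1})$. *)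

(* Defs.v *)
From Stdlib Require Import Reals Lra.
From Coquelicot Require Import Coquelicot.
Open Scope R_scope.

(* A function on the open quadrant (0,+oo)^2 is represented by a total function
   R -> R -> R; every condition below only looks at points of the quadrant,
   which is open, so values elsewhere are irrelevant. *)

Definition D_a (f : R -> R -> R) (a b : R) : R := Derive (fun x => f x b) a.
Definition D_b (f : R -> R -> R) (a b : R) : R := Derive (fun y => f a y) b.
Definition D_aa (f : R -> R -> R) : R -> R -> R := D_a (D_a f).
Definition D_ab (f : R -> R -> R) : R -> R -> R := D_b (D_a f).
Definition D_bb (f : R -> R -> R) : R -> R -> R := D_b (D_b f).

Definition C2 (f : R -> R -> R) : Prop :=
  forall a b, 0 < a -> 0 < b -> ex_diff_n f 2 a b.

Definition symmetric (f : R -> R -> R) : Prop :=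
  forall a b, 0 < a -> 0 < b -> f a b = f b a.

Definition homogeneous (s : R) (f : R -> R -> R) : Prop :=
  forall t a b, 0 < t -> 0 < a -> 0 < b ->
    f (t * a) (t * b) = Rpower t s * f a b.

Record normal_velocity (F : R -> R -> R) : Prop := {
  nv_C2 : C2 F;
  nv_symmetric : symmetric F;
  nv_homogeneous : exists sigma, sigma <> 0 /\ homogeneous sigma F;
  nv_D_a_gt0 : forall a b, 0 < a -> 0 < b -> 0 < D_a F a b;
  nv_D_b_gt0 : forall a b, 0 < a -> 0 < b -> 0 < D_b F a b
}.

Definition contracting (F : R -> R -> R) : Prop :=
  forall a b, 0 < a -> 0 < b -> 0 < F a b.
Definition expanding (F : R -> R -> R) : Prop :=
  forall a b, 0 < a -> 0 < b -> F a b < 0.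

Definition alpha (w : R -> R -> R) (a b : R) : R := - D_a w a b / D_b w a b.

Definition C_term (F w : R -> R -> R) (a b : R) : R :=
  let Fa := D_a F a b in
  let Fb := D_b F a b in
  D_a w a b * a *
    ((Fa * a ^ 2 + Fb * b ^ 2) + (F a b - Fa * a - Fb * b) * a) +
  D_b w a b * b *
    ((Fa * a ^ 2 + Fb * b ^ 2) + (F a b - Fa * a - Fb * b) * b).

(* f_aa + 2 f_ab alpha + f_bb alpha^2, with alpha = - w_a / w_b *)
Definition hess (w f : R -> R -> R) (a b : R) : R :=
  D_aa f a b + 2 * D_ab f a b * alpha w a b + D_bb f a b * alpha w a b ^ 2.

Definition E_term (F w : R -> R -> R) (a b : R) : R :=
  D_a w a b * hess w F a b - D_a F a b * hess w w a b +
  2 * ((D_b w a b * D_a F a b - D_a w a b * D_b F a b) / (a - b)) *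
    alpha w a b ^ 2.

Definition G_term (F w : R -> R -> R) (a b : R) : R :=
  / alpha w a b ^ 2 *
  (D_b w a b * hess w F a b - D_b F a b * hess w w a b +
   2 * ((D_b w a b * D_a F a b - D_a w a b * D_b F a b) / (a - b))).

(* u rho = v rho + o(1 / rho) as rho -> 0, rho > 0 *)
Definition eq_o_inv (u v : R -> R) : Prop :=
  is_domin (at_right 0) (fun rho : R => / rho) (fun rho : R => u rho - v rho).

Definition asympt_const (w : R -> R -> R) (c : R) : Prop :=
  at_right 0 (fun rho => alpha w rho 1 = c /\ D_a (alpha w) rho 1 = 0).

Definition asympt_inv (w : R -> R -> R) (c : R) : Prop :=
  eq_o_inv (fun rho => alpha w rho 1) (fun rho => c / rho) /\
  eq_o_inv (fun rho => D_a (alpha w) rho 1) (fun rho => - (c / rho ^ 2)).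

Definition asympt_inv2 (w : R -> R -> R) (c d : R) : Prop :=
  eq_o_inv (fun rho => alpha w rho 1) (fun rho => (c + d * rho) / rho ^ 2) /\
  eq_o_inv (fun rho => D_a (alpha w) rho 1)
    (fun rho => - ((2 * c + d * rho) / rho ^ 3)).

Record MPF_of_degree (F w : R -> R -> R) (chi : R) : Prop := {
  mpf_C2 : C2 w;
  mpf_symmetric : symmetric w;
  mpf_degree_neq0 : chi <> 0;
  mpf_homogeneous : homogeneous chi w;
  mpf_gt0 : forall a b, 0 < a -> 0 < b -> a <> b -> 0 < w a b;
  mpf_diag : forall a, 0 < a -> w a a = 0;
  mpf_contracting_degree : contracting F -> 0 < chi;
  mpf_expanding_degree : expanding F -> chi < 0;
  mpf_D_a_lt0 : forall a b, 0 < a -> a < b -> D_a w a b < 0;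
  mpf_D_a_gt0 : forall a b, 0 < b -> b < a -> 0 < D_a w a b;
  mpf_C : forall a b, 0 < a -> 0 < b -> C_term F w a b <= 0;
  mpf_E : forall a b, 0 < a -> 0 < b -> a <> b -> E_term F w a b <= 0;
  mpf_G : forall a b, 0 < a -> 0 < b -> a <> b -> G_term F w a b <= 0;
  mpf_asympt : exists c d, 0 < c /\
    (contracting F -> asympt_const w c \/ asympt_inv w c) /\
    (expanding F -> asympt_inv w c \/ asympt_inv2 w c d)
}.

Definition MPF (F w : R -> R -> R) : Prop := exists chi, MPF_of_degree F w chi.

Definition normA (a b : R) : R := sqrt (a ^ 2 + b ^ 2).

Definition sgn_normA_power (sigma a b : R) : R :=
  sign sigma * Rpower (normA a b) sigma.

Lemma sum_sq_gt0 a b : 0 < a -> 0 < b -> 0 < a ^ 2 + b ^ 2.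
Proof. intros; nra. Qed.

Lemma sgn_normA_powerE sigma a b : sigma < 0 -> 0 < a -> 0 < b ->
  sgn_normA_power sigma a b = - Rpower (a ^ 2 + b ^ 2) (sigma / 2).
Proof.
intros hs ha hb; unfold sgn_normA_power, normA.
rewrite (sign_eq_m1 _ hs), <- Rpower_sqrt by now apply sum_sq_gt0.
rewrite Rpower_mult; replace (/ 2 * sigma) with (sigma / 2) by field; ring.
Qed.

Lemma sgn_normA_power_expanding sigma : sigma < 0 ->
  expanding (sgn_normA_power sigma).
Proof.
intros hs a b ha hb; rewrite sgn_normA_powerE by assumption.
unfold Rpower; pose proof (exp_pos (sigma / 2 * ln (a ^ 2 + b ^ 2))); lra.
Qed.

Lemma quadrant_locally_2d (P : R -> R -> Prop) a b :
  (forall u v, 0 < u -> 0 < v -> P u v) -> 0 < a -> 0 < b -> locally_2d P a b.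
Proof.
intros hP ha hb; exists (mkposreal _ (Rmin_pos _ _ ha hb)); simpl.
intros u v hu hv.
pose proof (Rmin_l a b); pose proof (Rmin_r a b).
apply Rabs_def2 in hu; apply Rabs_def2 in hv; apply hP; lra.
Qed.

Lemma ex_diff_n_quadrant f fa fb n :
  (forall u v, 0 < u -> 0 < v -> continuity_2d_pt f u v) ->
  (forall u v, 0 < u -> 0 < v -> is_derive (fun x => f x v) u (fa u v)) ->
  (forall u v, 0 < u -> 0 < v -> is_derive (fun y => f u y) v (fb u v)) ->
  (forall u v, 0 < u -> 0 < v -> ex_diff_n fa n u v) ->
  (forall u v, 0 < u -> 0 < v -> ex_diff_n fb n u v) ->
  forall a b, 0 < a -> 0 < b -> ex_diff_n f (S n) a b.
Proof.
intros hc ha hb hna hnb a b pa pb; split; [now apply hc|].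
split; [eexists; now apply ha|split; [eexists; now apply hb|split]].
- apply ex_diff_n_ext_loc with (f := fa); [|now apply hna].
  apply quadrant_locally_2d; trivial; intros u v pu pv.
  symmetry; apply is_derive_unique; now apply ha.
- apply ex_diff_n_ext_loc with (f := fb); [|now apply hnb].
  apply quadrant_locally_2d; trivial; intros u v pu pv.
  symmetry; apply is_derive_unique; now apply hb.
Qed.

(* The derivatives of a^i b^j (a^2+b^2)^p are sums of terms of the same kind. *)
Definition term (c : R) (i j : nat) (p a b : R) : R :=
  c * a ^ i * b ^ j * exp (p * ln (a ^ 2 + b ^ 2)).

Lemma continuity_2d_pt_pow f n x y :
  continuity_2d_pt f x y -> continuity_2d_pt (fun u v => f u v ^ n) x y.
Proof.
intros h; apply continuity_1d_2d_pt_comp with (f := fun t => t ^ n) (g := f);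
  [apply derivable_continuous_pt, derivable_pt_pow|exact h].
Qed.

Lemma term_continuity c i j p a b : 0 < a -> 0 < b ->
  continuity_2d_pt (term c i j p) a b.
Proof.
intros ha hb; unfold term.
repeat apply continuity_2d_pt_mult.
- apply continuity_2d_pt_const.
- apply continuity_2d_pt_pow, continuity_2d_pt_id1.
- apply continuity_2d_pt_pow, continuity_2d_pt_id2.
- apply continuity_1d_2d_pt_comp with
    (f := fun t => exp (p * ln t)) (g := fun u v => u ^ 2 + v ^ 2).
  + apply continuity_pt_filterlim.
    apply (@ex_derive_continuous R_AbsRing R_NormedModule
      (fun t => exp (p * ln t))).
    auto_derive; now apply sum_sq_gt0.
  + apply continuity_2d_pt_plus; apply continuity_2d_pt_pow;
      [apply continuity_2d_pt_id1|apply continuity_2d_pt_id2].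
Qed.

Lemma exp_ln_pred p s : 0 < s ->
  exp (p * ln s) * / s = exp ((p - 1) * ln s).
Proof.
intros hs; replace ((p - 1) * ln s) with (p * ln s + - ln s) by ring.
now rewrite exp_plus, exp_Ropp, exp_ln.
Qed.

Lemma term_is_derive_a c i j p a b : 0 < a -> 0 < b ->
  is_derive (fun x => term c i j p x b) a
    (term (c * INR i) (pred i) j p a b + term (2 * p * c) (S i) j (p - 1) a b).
Proof.
intros ha hb; pose proof (sum_sq_gt0 a b ha hb) as hs.
unfold term; auto_derive; [exact hs|].
rewrite <- exp_ln_pred by exact hs; simpl; field; simpl in hs; lra.
Qed.

Lemma term_is_derive_b c i j p a b : 0 < a -> 0 < b ->
  is_derive (fun y => term c i j p a y) b
    (term (c * INR j) i (pred j) p a b + term (2 * p * c) i (S j) (p - 1) a b).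
Proof.
intros ha hb; pose proof (sum_sq_gt0 a b ha hb) as hs.
unfold term; auto_derive; [exact hs|].
rewrite <- exp_ln_pred by exact hs; simpl; field; simpl in hs; lra.
Qed.

Lemma ex_diff_n_plus n : forall f g,
  (forall a b, 0 < a -> 0 < b -> ex_diff_n f n a b) ->
  (forall a b, 0 < a -> 0 < b -> ex_diff_n g n a b) ->
  forall a b, 0 < a -> 0 < b -> ex_diff_n (fun u v => f u v + g u v) n a b.
Proof.
induction n as [|n IH]; intros f g hf hg a b ha hb.
- split; [apply continuity_2d_pt_plus; [now apply hf|now apply hg]|trivial].
- apply ex_diff_n_quadrant with
    (fa := fun u v => D_a f u v + D_a g u v)
    (fb := fun u v => D_b f u v + D_b g u v); trivial.
  + intros u v hu hv; apply continuity_2d_pt_plus;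
      [now apply hf|now apply hg].
  + intros u v hu hv; apply (@is_derive_plus R_AbsRing R_NormedModule);
      apply Derive_correct; [now apply hf|now apply hg].
  + intros u v hu hv; apply (@is_derive_plus R_AbsRing R_NormedModule);
      apply Derive_correct; [now apply hf|now apply hg].
  + apply IH; intros u v hu hv; [now apply hf|now apply hg].
  + apply IH; intros u v hu hv; [now apply hf|now apply hg].
Qed.

Lemma term_ex_diff_n n : forall c i j p a b, 0 < a -> 0 < b ->
  ex_diff_n (term c i j p) n a b.
Proof.
induction n as [|n IH]; intros c i j p a b ha hb.
- split; [now apply term_continuity|trivial].
- eapply ex_diff_n_quadrant; trivial.
  + intros; now apply term_continuity.
  + intros; now apply term_is_derive_a.
  + intros; now apply term_is_derive_b.
  + intros; apply ex_diff_n_plus; intros; now try apply IH.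
  + intros; apply ex_diff_n_plus; intros; now try apply IH.
Qed.

Lemma sgn_normA_power_term sigma a b : sigma < 0 -> 0 < a -> 0 < b ->
  sgn_normA_power sigma a b = term (-1) 0 0 (sigma / 2) a b.
Proof.
intros; rewrite sgn_normA_powerE by assumption.
unfold term, Rpower; simpl; ring.
Qed.

Lemma sgn_normA_power_normal_velocity sigma : sigma < 0 ->
  normal_velocity (sgn_normA_power sigma).
Proof.
intros hs; split.
- intros a b ha hb.
  apply ex_diff_n_ext_loc with (f := term (-1) 0 0 (sigma / 2));
    [|now apply term_ex_diff_n].
  apply quadrant_locally_2d; trivial; intros u v hu hv.
  now rewrite sgn_normA_power_term.
- intros a b ha hb; unfold sgn_normA_power, normA.
  now rewrite (Rplus_comm (a ^ 2)).
- exists sigma; split; [lra|intros t a b ht ha hb].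
  unfold sgn_normA_power, normA.
  replace ((t * a) ^ 2 + (t * b) ^ 2) with (t ^ 2 * (a ^ 2 + b ^ 2)) by ring.
  pose proof (sum_sq_gt0 a b ha hb).
  rewrite sqrt_mult by nra; rewrite sqrt_pow2 by lra.
  rewrite <- Rpower_mult_distr; [ring|trivial|now apply sqrt_lt_R0].
- intros a b ha hb; unfold D_a.
  rewrite (Derive_ext_loc _ (fun x => term (-1) 0 0 (sigma / 2) x b)).
  + rewrite (is_derive_unique _ _ _ (term_is_derive_a _ _ _ _ _ _ ha hb)).
    unfold term; simpl.
    set (e := exp _); set (e' := exp _); assert (0 < e') by apply exp_pos.
    assert (0 < - sigma * a * e') by (repeat apply Rmult_lt_0_compat; lra).
    lra.
  + apply (locally_2d_1d_const_y (fun u v => sgn_normA_power sigma u v =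
      term (-1) 0 0 (sigma / 2) u v)), quadrant_locally_2d; trivial.
    intros; now apply sgn_normA_power_term.
- intros a b ha hb; unfold D_b.
  rewrite (Derive_ext_loc _ (fun y => term (-1) 0 0 (sigma / 2) a y)).
  + rewrite (is_derive_unique _ _ _ (term_is_derive_b _ _ _ _ _ _ ha hb)).
    unfold term; simpl.
    set (e := exp _); set (e' := exp _); assert (0 < e') by apply exp_pos.
    assert (0 < - sigma * b * e') by (repeat apply Rmult_lt_0_compat; lra).
    lra.
  + apply (locally_2d_1d_const_x (fun u v => sgn_normA_power sigma u v =
      term (-1) 0 0 (sigma / 2) u v)), quadrant_locally_2d; trivial.
    intros; now apply sgn_normA_power_term.
Qed.

(* Main.v *)
(* Only the condition [E_term <= 0] near [rho = 0] matters.  Divided by a positive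
   factor, [E_term] at [(rho, 1)] is a cubic in [alpha] with leading coefficient
   tending to [(2 - sigma) - 1 - 2 = - sigma - 1 > 0], up to a term in
   [alpha_a] that is negligible because both admissible asymptotics give
   [alpha >= k / rho] and [|alpha_a| rho <= K alpha]. *)
Require Import Defs.
From Stdlib Require Import Reals Lra.
From Coquelicot Require Import Coquelicot.
Open Scope R_scope.

(** * Right neighbourhoods and partial derivatives on the open quadrant *)

Lemma at_right_interval (l r : R) : l < r ->
  at_right l (fun x => l < x < r).
Proof.
intros hr; assert (hd : 0 < r - l) by lra.
exists (mkposreal _ hd); intros x hx hl; unfold ball in hx; simpl in hx.
unfold AbsRing_ball, abs, minus, plus, opp in hx; simpl in hx.
apply Rabs_def2 in hx; lra.
Qed.

Lemma locally_pos x : 0 < x -> locally x (fun y => 0 < y).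
Proof. intros hx; now apply (open_gt 0 x). Qed.

(** A derivative depends only on values near the point, and the quadrant is open. *)
Lemma D_a_ext f g a b :
  (forall u v, 0 < u -> 0 < v -> f u v = g u v) -> 0 < a -> 0 < b ->
  D_a f a b = D_a g a b.
Proof.
intros h ha hb; apply Derive_ext_loc.
apply (filter_imp (fun y => 0 < y)); [intros; now apply h|now apply locally_pos].
Qed.

Lemma D_b_ext f g a b :
  (forall u v, 0 < u -> 0 < v -> f u v = g u v) -> 0 < a -> 0 < b ->
  D_b f a b = D_b g a b.
Proof.
intros h ha hb; apply Derive_ext_loc.
apply (filter_imp (fun y => 0 < y)); [intros; now apply h|now apply locally_pos].
Qed.

(** Carries the sign conditions on [w_a] over to [w_b]. *)
Lemma D_b_symmetric w a b : symmetric w -> 0 < a -> 0 < b ->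
  D_b w a b = D_a w b a.
Proof.
intros h ha hb; apply Derive_ext_loc.
apply (filter_imp (fun y => 0 < y)); [intros; now apply h|now apply locally_pos].
Qed.

Lemma D_a_term c i j p a b : 0 < a -> 0 < b ->
  D_a (term c i j p) a b =
  term (c * INR i) (pred i) j p a b + term (2 * p * c) (S i) j (p - 1) a b.
Proof. intros; now apply is_derive_unique, term_is_derive_a. Qed.

Lemma D_b_term c i j p a b : 0 < a -> 0 < b ->
  D_b (term c i j p) a b =
  term (c * INR j) i (pred j) p a b + term (2 * p * c) i (S j) (p - 1) a b.
Proof. intros; now apply is_derive_unique, term_is_derive_b. Qed.

(** * Derivatives of the power velocity *)

Section PowerVelocity.

Variables (sigma : R) (F : R -> R -> R).
Hypothesis hF : forall a b, 0 < a -> 0 < b -> F a b = term (-1) 0 0 (sigma / 2) a b.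

Let q := sigma / 2 - 1.

Lemma power_velocity_D_a a b : 0 < a -> 0 < b ->
  D_a F a b = term (- sigma) 1 0 q a b.
Proof.
intros ha hb; rewrite (D_a_ext _ _ _ _ hF ha hb), D_a_term by assumption.
unfold term, q; simpl; field.
Qed.

Lemma power_velocity_D_b a b : 0 < a -> 0 < b ->
  D_b F a b = term (- sigma) 0 1 q a b.
Proof.
intros ha hb; rewrite (D_b_ext _ _ _ _ hF ha hb), D_b_term by assumption.
unfold term, q; simpl; field.
Qed.

(** This is the second derivative of [F] in the direction [(1, alpha)], tangent to the level curves
    of [w]. With [s = a^2 + b^2], the gradient of [F] is [- sigma s^q (a, b)]; differentiating [s^q]
    once more produces the factor [2 q = - (2 - sigma)]. *)
Lemma power_velocity_hess w a b : 0 < a -> 0 < b ->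
  hess w F a b =
  - sigma * exp ((q - 1) * ln (a ^ 2 + b ^ 2)) *
    ((a ^ 2 + b ^ 2) * (1 + alpha w a b ^ 2) -
     (2 - sigma) * (a + b * alpha w a b) ^ 2).
Proof.
intros ha hb; unfold hess, D_aa, D_ab, D_bb.
rewrite (D_a_ext _ _ _ _ power_velocity_D_a ha hb).
rewrite (D_b_ext _ _ _ _ power_velocity_D_a ha hb).
rewrite (D_b_ext _ _ _ _ power_velocity_D_b ha hb).
rewrite D_a_term, !D_b_term by assumption.
unfold term; pose proof (sum_sq_gt0 a b ha hb) as hs.
rewrite <- (exp_ln_pred q _ hs).
set (e := exp _); unfold q; cbn [INR pred].
set (A := alpha w a b).
field; lra.
Qed.

End PowerVelocity.

(** * Derivatives of a homogeneous function along [b = 1] *)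

(* By homogeneity [w a b = b^chi * w (a / b) 1], so all derivatives of [w] on the
   line [b = 1] come from the one-variable function [fun x => w x 1]. *)
Section Homogeneous.

Variables (w : R -> R -> R) (chi : R).
Hypothesis hC2 : C2 w.
Hypothesis hhom : homogeneous chi w.

Let g (x : R) := w x 1.
Let g' (x : R) := Derive g x.
Let g'' (x : R) := Derive g' x.

Lemma slice_is_derive x : 0 < x -> is_derive g x (g' x).
Proof. intros hx; apply Derive_correct, (hC2 x 1); lra. Qed.

Lemma slice_is_derive2 x : 0 < x -> is_derive g' x (g'' x).
Proof.
intros hx; apply Derive_correct.
destruct (hC2 x 1 hx Rlt_0_1) as (_ & _ & _ & [_ [h _]] & _); exact h.
Qed.

Lemma homogeneous_slice a b : 0 < a -> 0 < b ->
  w a b = exp (chi * ln b) * g (a / b).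
Proof.
intros ha hb; unfold g.
replace (exp (chi * ln b)) with (Rpower b chi) by reflexivity.
rewrite <- hhom; trivial; try lra.
- f_equal; field; lra.
- now apply Rdiv_lt_0_compat.
Qed.

Lemma homogeneous_D_a a b : 0 < a -> 0 < b ->
  D_a w a b = exp (chi * ln b) / b * g' (a / b).
Proof.
intros ha hb; rewrite (D_a_ext _ _ _ _ homogeneous_slice ha hb).
assert (hab : 0 < a / b) by now apply Rdiv_lt_0_compat.
pose proof (slice_is_derive _ hab) as h.
apply is_derive_unique; auto_derive.
- now exists (g' (a / b)).
- fold (a / b); change (Derive (fun x => g x)) with g'; field; lra.
Qed.

Lemma homogeneous_D_b a b : 0 < a -> 0 < b ->
  D_b w a b = exp (chi * ln b) / b * (chi * g (a / b) - a / b * g' (a / b)).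
Proof.
intros ha hb; rewrite (D_b_ext _ _ _ _ homogeneous_slice ha hb).
assert (hab : 0 < a / b) by now apply Rdiv_lt_0_compat.
pose proof (slice_is_derive _ hab) as h.
apply is_derive_unique; auto_derive.
- repeat split; trivial; try lra; now exists (g' (a / b)).
- fold (a / b); change (Derive (fun x => g x)) with g'; field; lra.
Qed.

Lemma homogeneous_D_ab a : 0 < a ->
  D_ab w a 1 = (chi - 1) * g' a - a * g'' a.
Proof.
intros ha; unfold D_ab.
rewrite (D_b_ext _ _ _ _ homogeneous_D_a ha Rlt_0_1).
assert (ha1 : a / 1 = a) by field.
pose proof (slice_is_derive2 _ ha) as h.
apply is_derive_unique; auto_derive.
- repeat split; try lra; fold (a / 1); rewrite ha1; now exists (g'' a).
- fold (a / 1); rewrite ha1, ln_1, Rmult_0_r, exp_0; change (Derive (fun x => g' x)) with g''; field.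
Qed.

Lemma homogeneous_D_bb a : 0 < a ->
  D_bb w a 1 = chi * (chi - 1) * g a - 2 * (chi - 1) * a * g' a + a ^ 2 * g'' a.
Proof.
intros ha; unfold D_bb.
rewrite (D_b_ext _ _ _ _ homogeneous_D_b ha Rlt_0_1).
assert (ha1 : a / 1 = a) by field.
pose proof (slice_is_derive _ ha) as h1.
pose proof (slice_is_derive2 _ ha) as h.
apply is_derive_unique; auto_derive.
- repeat split; try lra; fold (a / 1); rewrite ha1;
    [now exists (g' a)|now exists (g'' a)].
- fold (a / 1); rewrite ha1, ln_1, Rmult_0_r, exp_0; change (Derive (fun x => g' x)) with g'';
  change (Derive (fun x => g x)) with g'; field.
Qed.

Lemma homogeneous_D_b1 a : 0 < a -> D_b w a 1 = chi * g a - a * g' a.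
Proof.
intros ha; rewrite homogeneous_D_b by lra.
replace (a / 1) with a by field; rewrite ln_1, Rmult_0_r, exp_0; field.
Qed.

(** Conceptually, differentiating [w_a + alpha w_b = 0] along [(1, alpha)] turns the Hessian term
    into [- w_b (alpha_a + alpha alpha_b)], and [alpha] has degree 0, so [alpha_b = - a alpha_a] at
    [b = 1]. The proof verifies the identity by expressing both sides through [g], [g'] and
    [g'']. *)
Lemma homogeneous_hess a : 0 < a -> D_b w a 1 <> 0 ->
  hess w w a 1 =
  - D_b w a 1 * D_a (alpha w) a 1 * (1 - alpha w a 1 * a).
Proof.
intros ha hQ.
assert (hA : alpha w a 1 = - g' a / (chi * g a - a * g' a)).
{ unfold alpha; now rewrite <- homogeneous_D_b1. }
rewrite homogeneous_D_b1 in hQ |- * by trivial.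
assert (hA' : D_a (alpha w) a 1 =
  - (g'' a * (chi * g a - a * g' a) -
     g' a * (chi * g' a - g' a - a * g'' a)) / (chi * g a - a * g' a) ^ 2).
{ pose proof (slice_is_derive _ ha) as h1.
  pose proof (slice_is_derive2 _ ha) as h.
  unfold D_a at 1.
  rewrite (Derive_ext_loc _ (fun x => - g' x / (chi * g x - x * g' x))).
  - apply is_derive_unique; auto_derive.
    + repeat split; trivial; [now exists (g'' a)|now exists (g' a)|now exists (g'' a)].
    + change (Derive (fun x => g' x)) with g'';
      change (Derive (fun x => g x)) with g'; field; exact hQ.
  - apply (filter_imp (fun y => 0 < y)); [|now apply locally_pos].
    intros y hy; unfold alpha; now rewrite homogeneous_D_b1. }
unfold hess; rewrite homogeneous_D_ab, homogeneous_D_bb, hA, hA' by trivial.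
replace (D_aa w a 1) with (g'' a) by reflexivity.
field; exact hQ.
Qed.

End Homogeneous.

(** * The condition on [E_term] as a cubic inequality in [alpha] *)

(** Substituting [w_a = - A w_b], every summand of [E_term] contains the positive factor
    [w_b * (- sigma) * s^(sigma / 2 - 2)]; the left side is the quotient. *)
Lemma power_velocity_E_term sigma F w chi rho :
  sigma < 0 ->
  (forall a b, 0 < a -> 0 < b -> F a b = term (-1) 0 0 (sigma / 2) a b) ->
  C2 w -> homogeneous chi w -> 0 < rho < 1 -> 0 < D_b w rho 1 ->
  E_term F w rho 1 <= 0 ->
  let A := alpha w rho 1 in
  let s := 1 + rho ^ 2 in
  (2 - sigma) * (rho + A) ^ 2 * A - A * s * (1 + A ^ 2) -
  2 * s * (rho + A) * A ^ 2 / (1 - rho) +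
  s * rho * D_a (alpha w) rho 1 * (1 - A * rho) <= 0.
Proof.
intros hs hF hC2 hhom hrho hQ hE A s.
assert (h0 : 0 < rho) by lra.
assert (hP : D_a w rho 1 = - A * D_b w rho 1) by (unfold A, alpha; field; lra).
unfold E_term in hE.
rewrite (power_velocity_hess sigma F hF w rho 1 h0 Rlt_0_1),
  (homogeneous_hess w chi hC2 hhom rho h0), hP,
  (power_velocity_D_a sigma F hF rho 1 h0 Rlt_0_1),
  (power_velocity_D_b sigma F hF rho 1 h0 Rlt_0_1) in hE by lra.
unfold term in hE; fold A in hE.
replace (rho ^ 2 + 1 ^ 2) with s in hE by (unfold s; ring).
assert (hs0 : 0 < s) by (unfold s; nra).
(* First derivatives of [F] carry one more power of [s] than [hess w F]; a common exponential makes
   it possible to factor it out. *)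
assert (he : exp ((sigma / 2 - 1) * ln s) =
  exp ((sigma / 2 - 1 - 1) * ln s) * s).
{ rewrite <- (exp_ln_pred (sigma / 2 - 1) _ hs0); field; lra. }
rewrite he in hE.
set (e := exp _) in hE; assert (0 < e) by apply exp_pos.
set (Q := D_b w rho 1) in *; set (A' := D_a (alpha w) rho 1) in *.
assert (hpos : 0 < Q * - sigma * e) by (repeat apply Rmult_lt_0_compat; lra).
apply Rmult_le_reg_l with (1 := hpos); rewrite Rmult_0_r.
refine (Rle_trans _ _ _ (Req_le _ _ _) hE).
field; lra.
Qed.

(** Here [n] stands for [2 - sigma], [A] for [alpha] and [A'] for [alpha_a]. The bound is uniform in
    [A] and [A']: after division by [A ^ 3], everything is controlled by [1 / A <= rho / k] and
    [|A'| rho / A <= K]. *)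
Lemma cubic_gt0 (n k K : R) : 3 < n -> 0 < k -> 0 < K ->
  at_right 0 (fun rho : R => forall A A',
    k / rho <= A -> Rabs A' * rho <= K * A ->
    let s := 1 + rho ^ 2 in
    0 < n * (rho + A) ^ 2 * A - A * s * (1 + A ^ 2) -
      2 * s * (rho + A) * A ^ 2 / (1 - rho) + s * rho * A' * (1 - A * rho)).
Proof.
intros hn hk hK.
(* A lower bound for the quotient by [A ^ 3] that is free of [A] and [A']: [1 / A] is replaced by
   [rho / k], the [A'] term by its worst case, and [(1 + rho / A) ^ 2] by 1. It is continuous with
   [h 0 = n - 3 > 0]. *)
set (h := fun rho => n - (1 + rho ^ 2) *
  (1 + (rho / k) ^ 2 + 2 * (1 + rho * (rho / k)) / (1 - rho) +
   K * ((rho / k) ^ 2 + rho * (rho / k)))).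
assert (h0 : at_right 0 (fun rho => 0 < h rho)).
{ apply filter_le_within.
  assert (hc : continuous h 0).
  { apply (@ex_derive_continuous R_AbsRing R_NormedModule); unfold h.
    auto_derive; lra. }
  apply hc, (open_gt 0); unfold h, Rdiv.
  rewrite !Rmult_0_l, Rminus_0_r, Rinv_1; lra. }
generalize (filter_and _ _ h0 (at_right_interval 0 1 Rlt_0_1)).
apply filter_imp; clear h0; intros rho [hh hr] A A' hA hA' s.
assert (hA0 : 0 < A).
{ refine (Rlt_le_trans _ _ _ _ hA); apply Rdiv_lt_0_compat; lra. }
set (y := / A).
assert (hy0 : 0 < y) by now apply Rinv_0_lt_compat.
assert (hy : y <= rho / k).
{ replace (rho / k) with (/ (k / rho)) by (field; lra).
  apply Rinv_le_contravar; trivial; apply Rdiv_lt_0_compat; lra. }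
assert (hAy : A = / y) by (unfold y; now rewrite Rinv_inv).
assert (hs : 0 < s) by (unfold s; nra).
(* Dividing by [A ^ 3] leaves a perturbation of [n - 3]. *)
set (T := A' * rho * y).
assert (hT : Rabs T <= K).
{ unfold T; rewrite !Rabs_mult, (Rabs_pos_eq rho), (Rabs_pos_eq y) by lra.
  apply Rmult_le_reg_r with A; trivial.
  replace (Rabs A' * rho * y * A) with (Rabs A' * rho)
    by (unfold y; field; lra); lra. }
replace (_ + _) with (A ^ 3 * (n * (1 + rho * y) ^ 2 -
  s * (1 + y ^ 2 + 2 * (1 + rho * y) / (1 - rho) - T * (y ^ 2 - rho * y))))
  by (unfold T; rewrite hAy; field; lra).
apply Rmult_lt_0_compat; [now apply pow_lt|].
unfold h in hh; fold s in hh.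
set (z := rho / k) in *.
assert (hyz : y ^ 2 <= z ^ 2) by (apply pow_incr; lra).
assert (hry : rho * y <= rho * z) by (apply Rmult_le_compat_l; lra).
assert (hry0 : 0 < rho * y) by (apply Rmult_lt_0_compat; lra).
assert (hy2 : 0 < y ^ 2) by now apply pow_lt.
assert (hdiv : 2 * (1 + rho * y) / (1 - rho) <= 2 * (1 + rho * z) / (1 - rho)).
{ apply Rmult_le_compat_r; [|lra].
  apply Rlt_le, Rinv_0_lt_compat; lra. }
assert (hTy : - (T * (y ^ 2 - rho * y)) <= K * (z ^ 2 + rho * z)).
{ apply Rabs_le_between in hT.
  assert (- T * y ^ 2 <= K * y ^ 2) by (apply Rmult_le_compat_r; lra).
  assert (T * (rho * y) <= K * (rho * y)) by (apply Rmult_le_compat_r; lra).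
  assert (K * (y ^ 2 + rho * y) <= K * (z ^ 2 + rho * z))
    by (apply Rmult_le_compat_l; lra).
  lra. }
assert (hn1 : n <= n * (1 + rho * y) ^ 2).
{ assert (1 <= (1 + rho * y) ^ 2) by (apply pow_R1_Rle; lra); nra. }
refine (Rlt_le_trans _ _ _ hh _).
apply Rplus_le_compat; [exact hn1|].
apply Ropp_le_contravar, Rmult_le_compat_l; lra.
Qed.

(** * Blow-up of [alpha] from the admissible asymptotics *)

Lemma eq_o_inv_le u v eps : eq_o_inv u v -> 0 < eps ->
  at_right 0 (fun rho => 0 < rho < 1 /\ Rabs (u rho - v rho) <= eps / rho).
Proof.
intros h he; specialize (h (mkposreal eps he)); simpl in h.
generalize (filter_and _ _ (at_right_interval 0 1 Rlt_0_1) h).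
apply filter_imp; intros rho [hr hu]; split; trivial.
change (Rabs (u rho - v rho) <= eps * Rabs (/ rho)) in hu.
rewrite (Rabs_pos_eq (/ rho)) in hu; [exact hu|].
apply Rlt_le, Rinv_0_lt_compat; lra.
Qed.

(** The common consequence of both expanding asymptotics, in the form that [cubic_gt0] takes as
    input. *)
Definition blowup_with (w : R -> R -> R) (k K : R) : Prop :=
  at_right 0 (fun rho => k / rho <= alpha w rho 1 /\
    Rabs (D_a (alpha w) rho 1) * rho <= K * alpha w rho 1).

(** An error of [(c / 2) / rho] leaves half of [c / rho]. For [rho < 1] it also gives [|alpha_a|
    rho^2 <= c + c rho / 2 <= 3 c / 2], hence the constant 3. *)
Lemma asympt_inv_blowup w c : 0 < c -> asympt_inv w c ->
  blowup_with w (c / 2) 3.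
Proof.
intros hc [h1 h2]; assert (hc2 : 0 < c / 2) by lra; unfold blowup_with.
generalize (filter_and _ _ (eq_o_inv_le _ _ _ h1 hc2) (eq_o_inv_le _ _ _ h2 hc2)).
apply filter_imp; intros rho [[hr ha] [_ ha']].
set (A := alpha w rho 1) in *; set (A' := D_a (alpha w) rho 1) in *.
assert (hA : c / 2 / rho <= A).
{ apply Rabs_le_between in ha.
  replace (c / rho) with (2 * (c / 2 / rho)) in ha by (field; lra); lra. }
split; trivial.
assert (h3 : Rabs A' <= c / rho ^ 2 + c / 2 / rho).
{ assert (0 < c / rho ^ 2) by (apply Rdiv_lt_0_compat; [lra|apply pow_lt; lra]).
  apply Rabs_le_between in ha'; apply Rabs_le_between; lra. }
apply Rle_trans with (3 * (c / 2 / rho)); [|lra].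
apply Rle_trans with ((c / rho ^ 2 + c / 2 / rho) * rho);
  [apply Rmult_le_compat_r; lra|].
apply Rmult_le_reg_r with rho; [lra|].
replace (_ * rho) with (c + c / 2 * rho) by (field; lra).
replace (3 * _ * rho) with (3 * (c / 2)) by (field; lra).
nra.
Qed.

(** Near 0, [alpha >= (c / 2) / rho^2], while [|alpha_a| rho^3 <= 2 c + |d| + 1]; the second
    constant is the ratio of these two bounds. *)
Lemma asympt_inv2_blowup w c d : 0 < c -> asympt_inv2 w c d ->
  blowup_with w (c / 2) (2 * (2 * c + Rabs d + 1) / c).
Proof.
intros hc [h1 h2]; pose proof (Rabs_pos d) as hd; unfold blowup_with.
(* Below this threshold, [|d| rho] and the error [rho], both scaled by [rho^2], together cost at
   most [c / 2]. *)
assert (hr0 : 0 < c / (2 * (Rabs d + 1))) by (apply Rdiv_lt_0_compat; lra).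
generalize (filter_and _ _ (at_right_interval _ _ hr0) (filter_and _ _
  (eq_o_inv_le _ _ _ h1 Rlt_0_1) (eq_o_inv_le _ _ _ h2 Rlt_0_1))).
apply filter_imp; intros rho [[_ hrc] [[hr ha] [_ ha']]].
set (A := alpha w rho 1) in *; set (A' := D_a (alpha w) rho 1) in *.
assert (hrc' : (Rabs d + 1) * rho <= c / 2).
{ apply Rmult_lt_compat_l with (r := Rabs d + 1) in hrc; [|lra].
  replace (c / 2) with ((Rabs d + 1) * (c / (2 * (Rabs d + 1)))) by (field; lra).
  lra. }
assert (hdr : - (Rabs d * rho) <= d * rho <= Rabs d * rho).
{ pose proof (Rle_abs d); pose proof (Rle_abs (- d)) as h; rewrite Rabs_Ropp in h.
  split; nra. }
assert (hr2 : 0 < rho ^ 2) by (apply pow_lt; lra).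
assert (hr3 : 0 < rho ^ 3) by (apply pow_lt; lra).
assert (hA : c / 2 / rho ^ 2 <= A).
{ apply Rabs_le_between in ha.
  apply Rle_trans with ((c + d * rho) / rho ^ 2 - 1 / rho); [|lra].
  apply Rmult_le_reg_r with (rho ^ 2); trivial.
  replace (c / 2 / _ * _) with (c / 2) by (field; lra).
  replace (_ * rho ^ 2) with (c + d * rho - rho) by (field; lra); lra. }
split.
- refine (Rle_trans _ _ _ _ hA).
  apply Rmult_le_compat_l; [lra|].
  apply Rinv_le_contravar; trivial; simpl; nra.
- assert (h3 : Rabs A' <= (2 * c + Rabs d + 1) / rho ^ 3).
  { apply Rle_trans with (Rabs (2 * c + d * rho) / rho ^ 3 + 1 / rho).
    - pose proof (Rabs_triang (A' - - ((2 * c + d * rho) / rho ^ 3))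
        (- ((2 * c + d * rho) / rho ^ 3))) as h.
      replace (_ - _ + _) with A' in h by ring.
      rewrite (Rabs_Ropp (_ / _)), Rabs_div, (Rabs_pos_eq (rho ^ 3)) in h by lra.
      lra.
    - apply Rmult_le_reg_r with (rho ^ 3); trivial.
      replace ((_ + 1 / rho) * _) with (Rabs (2 * c + d * rho) + rho ^ 2)
        by (field; lra).
      replace (_ / _ * _) with (2 * c + Rabs d + 1) by (field; lra).
      rewrite Rabs_pos_eq by nra; nra. }
  apply Rle_trans with ((2 * c + Rabs d + 1) / rho ^ 3 * rho);
    [apply Rmult_le_compat_r; lra|].
  replace (_ / _ * rho) with
    (2 * (2 * c + Rabs d + 1) / c * (c / 2 / rho ^ 2)) by (field; lra).
  apply Rmult_le_compat_l; trivial.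
  apply Rlt_le, Rdiv_lt_0_compat; lra.
Qed.

(** * Contradiction at a small [rho] *)

Theorem theorem9p1 (sigma : R) (hsigma : sigma < -1) (F : R -> R -> R)
  (hFnv : normal_velocity F)
  (hF : forall a b : R, 0 < a -> 0 < b -> F a b = sgn_normA_power sigma a b) :
  ~ exists w : R -> R -> R, MPF F w.
Proof.
intros [w [chi M]].
assert (hs : sigma < 0) by lra.
assert (hFt : forall a b, 0 < a -> 0 < b ->
  F a b = term (-1) 0 0 (sigma / 2) a b).
{ intros a b ha hb; now rewrite hF, sgn_normA_power_term. }
assert (hexp : expanding F).
{ intros a b ha hb; rewrite hF by assumption; now apply sgn_normA_power_expanding. }
assert (hb : exists k K, 0 < k /\ 0 < K /\ blowup_with w k K).
{ destruct (mpf_asympt _ _ _ M) as (c & d & hc & _ & [h|h]%(fun h => h hexp)).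
  - exists (c / 2), 3; repeat split; try lra; now apply asympt_inv_blowup.
  - pose proof (Rabs_pos d).
    exists (c / 2), (2 * (2 * c + Rabs d + 1) / c); repeat split; try lra.
    + apply Rdiv_lt_0_compat; lra.
    + now apply asympt_inv2_blowup. }
destruct hb as (k & K & hk & hK & hb).
(* This is exactly [sigma < -1]: the limiting leading coefficient is positive. *)
assert (hn : 3 < 2 - sigma) by lra.
generalize (filter_and _ _ (at_right_interval 0 1 Rlt_0_1)
  (filter_and _ _ hb (cubic_gt0 _ _ _ hn hk hK))); intros hev.
(* A property holding eventually on the right of 0 holds at some [rho]. *)
destruct (filter_ex _ hev) as (rho & hr & [hA hA'] & hpos).
specialize (hpos _ _ hA hA'); cbv zeta in hpos.
apply (Rlt_not_le _ _ hpos).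
apply (power_velocity_E_term sigma F w chi rho hs hFt (mpf_C2 _ _ _ M)
  (mpf_homogeneous _ _ _ M) hr).
(* By symmetry [w_b] at [(rho, 1)] is [w_a] at [(1, rho)], which is positive since [rho < 1]. *)
- rewrite D_b_symmetric by (lra || apply (mpf_symmetric _ _ _ M)).
  apply (mpf_D_a_gt0 _ _ _ M); lra.
- apply (mpf_E _ _ _ M); lra.
Qed.
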